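(* Let $q$ be a prime power and let $1 \leq k < n$ be integers. If the statement $A(n,k)$ holds with constant $0 < C_{n,k} \leq 1$, then the statement $B(n,k)$ holds with constant $$D_{n,k} = \frac{k}{n} \cdot \log_q\left(\frac{1}{C_{n,k}}\right).$$
   Context: $\mathbb{F}_q$ is the finite field with $q$ elements ($q$ is fixed), and linear means $\mathbb{F}_q$-linear. For integers $1 \leq k < n$ and $m \geq 1$, a subset $S \subseteq \mathbb{F}_q^n$ is $(k,m)$-Furstenberg if for each $k$-dimensional linear subspace $W$ of $\mathbb{F}_q^n$ there is a translate of $W$ that intersects $S$ in at least $m$ points. For a random variable $R$ taking values in $\mathbb{F}_q^N$, its $q$-ary min-entropy is $\mathbf{H}^q_\infty(R) = -\log_q\left(\max_{w \in \mathbb{F}_q^N} \Pr[R = w]\right)$. Statement $A(n,k)$ holds with constant $C_{n,k}$ if: for every $m$ and every $S \subseteq \mathbb{F}_q^n$ that is $(k,m)$-Furstenberg, $|S| \geq C_{n,k} \cdot m^{n/k}$. Statement $B(n,k)$ holds with constant $D_{n,k}$ if: for all $\delta \in [0,1]$, if $S \subseteq \mathbb{F}_q^n$ has size $|S| = q^{\delta n}$, then there exists an onto linear map $\varphi : \mathbb{F}_q^n \to \mathbb{F}_q^{n-k}$ such that $\mathbf{H}^q_\infty(\varphi(U_S)) \geq \delta(n-k) - D_{n,k}$, where $U_S$ is a random variable distributed uniformly over $S$. *)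

(* Defs.v *)
(* MathComp world, with MathComp-Analysis for the reals. *)
From HB Require Import structures.
From mathcomp Require Import all_boot all_order all_algebra.
From mathcomp Require Import reals exp.

Set Implicit Arguments.
Unset Strict Implicit.
Unset Printing Implicit Defensive.

Import Order.TTheory GRing.Theory Num.Theory.
Local Open Scope ring_scope.

Section Furstenberg.
Variables (F : finFieldType) (n : nat).

Definition translate (v : 'rV[F]_n) (W : {vspace 'rV[F]_n}) : {set 'rV[F]_n} :=
  [set v + w | w in W].

Definition furstenberg (k m : nat) (S : {set 'rV[F]_n}) : Prop :=
  forall W : {vspace 'rV[F]_n}, \dim W = k ->
    exists v : 'rV[F]_n, (m <= #|S :&: translate v W|)%N.

End Furstenberg.

Section Entropy.
Variable R : realType.

Definition logb (b x : R) : R := ln x / ln b.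

(* A finite probability space is a finType together with its mass function
   P : Omega -> R; a random variable is any function on Omega. *)
Definition Pr (Omega : finType) (P : Omega -> R) (E : pred Omega) : R :=
  \sum_(x | E x) P x.

Definition unif (T : finType) (S : {set T}) (x : T) : R :=
  if x \in S then #|S|%:R^-1 else 0.

Lemma unif_ge0 (T : finType) (S : {set T}) x : 0 <= unif S x.
Proof. by rewrite /unif; case: ifP; rewrite ?invr_ge0 ?ler0n. Qed.

Lemma unif_sum1 (T : finType) (S : {set T}) :
  S != set0 -> Pr (unif S) predT = 1.
Proof.
move=> S0; rewrite /Pr /unif -big_mkcond sumr_const -[LHS]mulr_natr mulVf //.
by rewrite pnatr_eq0 cards_eq0.
Qed.

(* Probabilities are nonnegative, so the default value 0 of the iterated
   maximum is harmless. *)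
Definition min_entropy (F : finFieldType) (N : nat) (Omega : finType)
    (P : Omega -> R) (X : Omega -> 'rV[F]_N) : R :=
  - logb #|F|%:R (\big[Num.max/0]_(w : 'rV[F]_N) Pr P [pred x | X x == w]).

End Entropy.

Section Statements.
Variables (R : realType) (F : finFieldType) (n k : nat).

Definition statementA (C : R) : Prop :=
  forall (m : nat) (S : {set 'rV[F]_n}), (1 <= m)%N ->
    furstenberg k m S ->
    C * m%:R `^ (n%:R / k%:R) <= #|S|%:R.

(* The identity on 'rV[F]_n with the law [unif R S] is the uniform variable on
   S, so its image under phi is phi itself viewed as a random variable. *)
Definition statementB (D : R) : Prop :=
  forall (delta : R) (S : {set 'rV[F]_n}), 0 <= delta <= 1 ->
    #|S|%:R = #|F|%:R `^ (delta * n%:R) ->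
    exists phi : 'Hom('rV[F]_n, 'rV[F]_(n - k)),
      limg phi = fullv /\
      delta * (n - k)%:R - D <= min_entropy (unif R S) phi.

End Statements.

(* Main.v *)
Require Import Defs.
From HB Require Import structures.
From mathcomp Require Import all_boot all_order all_algebra.
From mathcomp Require Import boolp.
From mathcomp Require Import reals sequences exp.
From mathcomp Require Import ring.

(** The argument is by thresholds.  Write q = #|F| and #|S| = q^(delta n), and
    let x = q^(delta k) (1/C)^(k/n), the real number with C x^(n/k) = #|S|.
    If m is the least integer above x then C m^(n/k) > #|S|, so by the
    hypothesis S is not (k, m)-Furstenberg: some k-dimensional W has all its
    translates meeting S in at most x points.  Choose an onto linear phi with
    kernel W ([lker_limg_exists]).  Its nonempty fibres are the translates of W
    ([fibre_translate]), so phi(U_S) takes every value with probability at most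
    x / #|S|, and - log_q (x / #|S|) is exactly
    delta (n - k) - (k / n) log_q (1 / C). *)

Import Order.TTheory GRing.Theory Num.Theory.
Local Open Scope ring_scope.

(** Every subspace of the right codimension is the kernel of a surjection:
    project onto a complement of [W] along [W], then send a basis of the
    complement to a basis of [rT]. *)
Lemma lker_limg_exists (K : fieldType) (vT rT : vectType K)
    (W : {vspace vT}) :
  (\dim W + \dim {:rT} = \dim {:vT})%N ->
  exists f : 'Hom(vT, rT), lker f = W /\ limg f = fullv.
Proof.
move=> dimW.
have dimC : \dim (W^C)%VS = \dim {:rT}.
  by rewrite dimv_compl -dimW addKn.
have dCW : (W^C :&: W = 0)%VS by rewrite capvC capv_compl.
set p := daddv_pi (W^C)%VS W.
set X := vbasis (W^C)%VS.
pose Y : (\dim (W^C)%VS).-tuple rT := tcast (esym dimC) (vbasis {:rT}).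
have Yfree : free Y.
  rewrite /Y val_tcast; exact: (basis_free (vbasisP _)).
pose f0 (v : vT) : rT := \sum_i coord X i (p v) *: Y`_i.
have f0lin : linear f0.
  move=> a u v; rewrite /f0 scaler_sumr -big_split /=.
  by apply: eq_bigr => i _; rewrite !linearP scalerDl scalerA.
pose f0M := GRing.isLinear.Build K vT rT *:%R f0 f0lin.
pose f0L : {linear vT -> rT} := HB.pack f0 f0M.
pose f := linfun f0L.
have kerf : lker f = W.
  apply/vspaceP => v; rewrite memv_ker lfunE /= /f0.
  have pv : p v \in (W^C)%VS by exact: memv_pi.
  have dec : v = p v + daddv_pi W (W^C)%VS v.
    by rewrite daddv_pi_add // addvC addv_complf memvf.
  apply/eqP/idP => [s0|vW].
    have c0 := freeP Yfree _ s0.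
    rewrite dec (coord_vbasis pv) big1 ?add0r ?memv_pi // => i _.
    by rewrite c0 scale0r.
  have pv0 : p v = 0.
    apply/eqP; rewrite -memv0 -dCW memv_cap pv /=.
    have -> : p v = v - daddv_pi W (W^C)%VS v by rewrite {2}dec addrK.
    by rewrite rpredB // memv_pi.
  by rewrite big1 // => i _; rewrite pv0 linear0 scale0r.
exists f; split=> //.
apply/eqP; rewrite eqEdim subvf /=.
by have := limg_ker_dim f fullv; rewrite kerf capfv -dimW => /addnI ->.
Qed.

Lemma fibre_translate (F : finFieldType) (n N : nat)
    (phi : 'Hom('rV[F]_n, 'rV[F]_N)) (v : 'rV[F]_n) :
  [set x | phi x == phi v] = translate v (lker phi).
Proof.
apply/setP => x; rewrite inE; apply/idP/imsetP => [/eqP e|[w wk ->]].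
  exists (x - v); last by rewrite addrC subrK.
  by rewrite memv_ker linearB /= e subrr.
by move: wk; rewrite memv_ker linearD /= => /eqP ->; rewrite addr0.
Qed.

Lemma Pr_unif (R : realType) (T : finType) (S : {set T}) (E : pred T) :
  Pr (unif R S) E = #|S :&: [set x | E x]|%:R / #|S|%:R.
Proof.
rewrite /Pr /unif -big_mkcondr /= sumr_const mulr_natl.
by congr (_ *+ _); apply: eq_card => x; rewrite !inE unfold_in andbC.
Qed.

(** If every translate of the kernel of [phi] meets [S] in at most [x] points,
    then the image of the uniform law on [S] has min-entropy at least
    [log_q (#|S| / x)]. *)
Lemma min_entropy_unif_ge (R : realType) (F : finFieldType) (n N : nat)
    (S : {set 'rV[F]_n}) (phi : 'Hom('rV[F]_n, 'rV[F]_N)) (x : R) :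
  S != set0 -> 0 < x ->
  (forall v, #|S :&: translate v (lker phi)|%:R <= x) ->
  logb #|F|%:R (#|S|%:R / x) <= min_entropy (unif R S) phi.
Proof.
move=> S0 x0 Hx.
have cS : 0 < #|S|%:R :> R by rewrite ltr0n card_gt0.
have lq : 0 < ln #|F|%:R :> R by rewrite ln_gt0 // ltr1n card_finNzRing_gt1.
rewrite /min_entropy /logb.
set M := \big[Num.max/0]_w _.
have M0 : 0 < M.
  case/set0Pn: S0 => s sS.
  apply: (@lt_le_trans _ _ (Pr (unif R S) [pred x | phi x == phi s])).
    rewrite Pr_unif divr_gt0 // ltr0n card_gt0; apply/set0Pn; exists s.
    by rewrite !inE sS /=.
  exact: le_bigmax.
have Mx : M <= x / #|S|%:R.
  apply: bigmax_le => [|w _]; first by rewrite divr_ge0 // ltW.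
  rewrite Pr_unif ler_pM2r ?invr_gt0 //.
  have [[v /eqP <-]|nv] := pselect (exists v, phi v == w).
    have -> : [set y | [pred x0 | phi x0 == phi v] y]
              = translate v (lker phi) by rewrite -fibre_translate.
    exact: Hx.
  rewrite (_ : _ :&: _ = set0) ?cards0 ?ltW //.
  by apply/setP => y; rewrite !inE; apply/negP => /andP[_ yw]; case: nv; exists y.
rewrite -mulNr ler_pM2r ?invr_gt0 // -lnV ?posrE //.
rewrite ler_ln ?posrE ?divr_gt0 ?invr_gt0 //.
by rewrite -[_ / x]invf_div lef_pV2 // posrE divr_gt0.
Qed.

Theorem lemma16 (R : realType) (F : finFieldType) (n k : nat) (C : R)
    (k_gt0 : (1 <= k)%N) (k_lt_n : (k < n)%N) (C_gt0 : 0 < C) (C_le1 : C <= 1)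
    (hA : statementA F n k C) :
  statementB F n k (k%:R / n%:R * logb #|F|%:R (1 / C)).
Proof.
move=> delta S _ cardS.
have q0 : 0 < #|F|%:R :> R by rewrite ltr0n ltnW // card_finNzRing_gt1.
have lq : 0 < ln #|F|%:R :> R by rewrite ln_gt0 // ltr1n card_finNzRing_gt1.
have cS : 0 < #|S|%:R :> R by rewrite cardS powR_gt0.
have S0 : S != set0 by rewrite -card_gt0 -(ltr0n R).
have lnS : ln #|S|%:R = delta * n%:R * ln #|F|%:R :> R.
  by rewrite cardS ln_powR.
have kR : 0 < k%:R :> R by rewrite ltr0n.
have nR : 0 < n%:R :> R by rewrite ltr0n (leq_trans _ k_lt_n).
have lnC : ln (1 / C) = - ln C by rewrite div1r lnV.
(* [L] is the logarithm of the threshold solving C x^(n/k) = #|S|. *)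
pose L : R := delta * k%:R * ln #|F|%:R - k%:R / n%:R * ln C.
pose x := expR L.
have x0 : 0 < x by exact: expR_gt0.
pose m := (Num.truncn x).+1.
have xm : x < m%:R by exact: truncnS_gt.
have notF : ~ furstenberg k m S.
  move=> /(hA m S isT).
  have m0 : 0 < m%:R :> R by rewrite ltr0n.
  rewrite -ler_ln ?posrE ?mulr_gt0 ?powR_gt0 // lnM ?posrE ?powR_gt0 //.
  rewrite ln_powR lnS; apply/negP; rewrite -ltNge.
  have -> : delta * n%:R * ln #|F|%:R = ln C + n%:R / k%:R * L.
    by rewrite /L; field; rewrite !gt_eqF.
  by rewrite ltrD2l ltr_pM2l ?divr_gt0 // -[L]expRK ltr_ln ?posrE.
have [W [dimW HW]] : exists W : {vspace 'rV[F]_n}, \dim W = k /\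
    forall v, #|S :&: translate v W|%:R <= x.
  apply: contrapT => nW; apply: notF => W dW.
  apply: contrapT => nv; apply: nW; exists W; split=> // v.
  rewrite -(@truncn_ge_nat _ x) ?ltW // -ltnS ltnNge.
  by apply/negP => mv; apply: nv; exists v.
have [phi [kerphi imphi]] : exists f : 'Hom('rV[F]_n, 'rV[F]_(n - k)),
    lker f = W /\ limg f = fullv.
  by apply: lker_limg_exists; rewrite dimW !dimvf /dim /= !mul1n subnKC // ltnW.
exists phi; split=> //.
apply: le_trans (@min_entropy_unif_ge _ _ _ _ S phi x S0 x0 _); last first.
  by move=> v; rewrite kerphi.
rewrite /logb lnC ln_div ?posrE // lnS /x expRK /L.
rewrite natrB ?(ltnW k_lt_n) // le_eqVlt; apply/orP; left; apply/eqP.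
by field; rewrite !gt_eqF.
Qed.
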